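(* For every integer $h\ge2$ and every real $r>0$, $$\lambda_h(r)^2\ge\lambda_{h-1}(r)\,\lambda_{h+1}(r),$$ and hence $$\Lambda_h(r)^2\ge\Lambda_{h-1}(r)\,\Lambda_{h+1}(r).$$
   Context: For $r>0$ and $h\ge1$, $A_h(r)$ is the $h\times h$ real symmetric tridiagonal matrix with zero diagonal and $(A_h(r))_{i,i+1}=(A_h(r))_{i+1,i}=r^{(i-1)/2}$ for $1\le i\le h-1$ (so $A_1(r)$ is the $1\times1$ zero matrix). $\lambda_h(r)$ denotes the spectral radius of $A_h(r)$ (so $\lambda_1(r)=0$), and $\Lambda_h(r)=\lambda_h(r)^2$. *)

(* Defs.v *)
From mathcomp Require Import all_boot all_order all_algebra.
From mathcomp Require Import complex.
From mathcomp Require Import all_classical all_reals all_analysis.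

Set Implicit Arguments.
Unset Strict Implicit.
Unset Printing Implicit Defensive.

Import Order.TTheory GRing.Theory Num.Theory.
Local Open Scope classical_set_scope.
Local Open Scope ring_scope.

(* The largest modulus of a complex eigenvalue.  The set is finite, and it is
   nonempty as soon as 0 < n, so that the supremum is then a maximum. *)
Definition spectral_radius (R : realType) (n : nat) (A : 'M[R]_n) : R :=
  sup [set ComplexField.Normc.normc z | z in
        [set z : R[i] | eigenvalue (map_mx (real_complex R) A) z]].

(* Indices start at 0 here, so the entry in positions (i, i+1) and (i+1, i) is
   r^(i/2) rather than r^((i-1)/2). *)
Definition tridiag (R : realType) (h : nat) (r : R) : 'M[R]_h :=
  \matrix_(i < h, j < h)
    if j == i.+1 :> nat then r `^ (i%:R / 2)
    else if i == j.+1 :> nat then r `^ (j%:R / 2)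
    else 0.

Definition lambda (R : realType) (h : nat) (r : R) : R :=
  spectral_radius (tridiag h r).

Definition Lambda (R : realType) (h : nat) (r : R) : R := lambda h r ^+ 2.

(* Main.v *)
Require Import Defs.
From mathcomp Require Import all_boot all_order all_algebra.
From mathcomp Require Import complex zify ring.
From mathcomp Require Import all_classical all_reals all_analysis.

(* Put s = sqrt r, and let p_0 = 1, p_1 = X, s^(k+1) p_(k+2) = X p_(k+1) - s^k p_k.
   The Perron vector of A_n is (p_0(l_n), ..., p_(n-1)(l_n)) with l_n = lambda_n.
   Deleting the first vertex of the weighted path h+1 leaves s A_h, so pairing
   the Perron vector of A_(h+1) with the shifted one of A_h gives
     (l_(h+1) - s l_h) * sum_(i < h) p_(i+1)(l_(h+1)) p_i(l_h) = 1.
   On the relevant range every p_i is positive and increasing, hence the sum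
   increases with h and l_(h+1) - s l_h <= l_h - s l_(h-1).  Multiplying by
   l_(h-1) <= l_h yields l_(h-1) l_(h+1) <= l_h^2. *)

Import Order.TTheory GRing.Theory Num.Theory.
Local Open Scope ring_scope.

(** * Orthogonal polynomials of the weighted path and their largest roots *)

Section JacobiPolynomials.
Context {R : rcfType}.
Implicit Types (s x y : R) (n k : nat).

(** Orthogonal polynomials of the Jacobi matrix with zero diagonal and weights [s ^+ k]; as elements
    of [{poly R}] they admit [poly_ivt]. *)
Fixpoint jacobi_poly s n : {poly R} :=
  if n is n'.+1 then
    if n' is k.+1 then
      (s ^+ n')^-1 *: ('X * jacobi_poly s n' - s ^+ k *: jacobi_poly s k)
    else 'X
  else 1.

Definition jac s n x : R := (jacobi_poly s n).[x].

Lemma jac0 s x : jac s 0 x = 1.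
Proof. exact: hornerC. Qed.

Lemma jac1 s x : jac s 1 x = x.
Proof. exact: hornerX. Qed.

Lemma jacSS s n x : s != 0 ->
  s ^+ n.+1 * jac s n.+2 x = x * jac s n.+1 x - s ^+ n * jac s n x.
Proof.
move=> s0; rewrite {1}/jac [jacobi_poly s n.+2]/= hornerZ mulrA divff;
  last by rewrite expf_neq0.
by rewrite mul1r hornerD hornerN !hornerZ mulrC hornerMX mulrC.
Qed.

(* The second conjunct says that p_(k+1) / p_k increases with the argument; it
   drives the induction. *)
Lemma jac_mono s x y n : 0 < s -> x <= y ->
  (forall k, (k < n)%N -> 0 < jac s k x) ->
  forall k, (k < n)%N -> jac s k x <= jac s k y /\
      jac s k.+1 x * jac s k y <= jac s k.+1 y * jac s k x.
Proof.
move=> s0 xy px; elim=> [|k IH] kn.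
  by rewrite !jac0 !jac1 !mulr1.
have [IH1 IH2] := IH (ltnW kn).
have pk := px _ (ltnW kn); have pk1 := px _ kn.
have m1 : jac s k.+1 x <= jac s k.+1 y.
  by rewrite -(ler_pM2r pk); apply: le_trans IH2; rewrite ler_pM2l.
split=> //.
have sk : 0 < s ^+ k.+1 by rewrite exprn_gt0.
have sk' : 0 < s ^+ k by rewrite exprn_gt0.
rewrite -(ler_pM2l sk) !mulrA !jacSS ?gt_eqF// -subr_ge0.
have -> : (y * jac s k.+1 y - s ^+ k * jac s k y) * jac s k.+1 x -
    (x * jac s k.+1 x - s ^+ k * jac s k x) * jac s k.+1 y =
    (y - x) * (jac s k.+1 x * jac s k.+1 y) +
    s ^+ k * (jac s k.+1 y * jac s k x - jac s k.+1 x * jac s k y) by ring.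
have py := lt_le_trans pk1 m1.
apply: addr_ge0.
  by apply: mulr_ge0; [rewrite subr_ge0 | rewrite mulr_ge0// ltW].
by apply: mulr_ge0; [exact: ltW | rewrite subr_ge0].
Qed.

(** The ratio bound of [jac_mono] carries monotonicity one index further, where the value at [x] may
    be zero, as at a top root. *)
Lemma jac_le s x y n : 0 < s -> x <= y ->
  (forall k, (k < n)%N -> 0 < jac s k x) -> 0 <= jac s n x ->
  jac s n x <= jac s n y.
Proof.
case: n => [|n] s0 xy px pn; first by rewrite !jac0.
have [m1 m2] := @jac_mono s x y n.+1 s0 xy px n (leqnn _).
rewrite -(ler_pM2r (px n (leqnn _))); apply: le_trans m2.
by rewrite ler_wpM2l.
Qed.

Lemma jac_eventually_pos s n x0 : 0 < s ->
  exists2 x, x0 <= x & forall k, (k <= n)%N -> 0 < jac s k x.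
Proof.
(* If [x] is at least each [b k], the recurrence keeps [jac s k x] nondecreasing in [k]. *)
move=> s0; pose b k : R := s ^+ k + s ^+ k.-1.
have b0 k : 0 <= b k by rewrite addr_ge0// exprn_ge0// ltW.
pose x := `|x0| + 1 + \sum_(k < n) b k; exists x.
  by rewrite /x -addrA (le_trans (ler_norm x0))// lerDl addr_ge0// sumr_ge0.
have xb k : (k < n)%N -> b k <= x.
  move=> kn; rewrite /x (bigD1 (Ordinal kn))//= addrCA lerDl.
  by rewrite addr_ge0 ?addr_ge0// sumr_ge0.
have x1 : 0 < x.
  by rewrite /x -addrA ltr_wpDl// ltr_pwDl// sumr_ge0.
have H k : (k < n)%N -> 0 < jac s k x <= jac s k.+1 x.
  elim: k => [|k IH] kn.
    rewrite jac0 jac1 ltr01/=; apply: le_trans (xb _ kn).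
    by rewrite /b expr0 lerDl.
  have /andP[pk pk1] := IH (ltnW kn).
  have pk1' := lt_le_trans pk pk1; rewrite pk1'/=.
  have sk : 0 < s ^+ k.+1 by rewrite exprn_gt0.
  rewrite -(ler_pM2l sk) jacSS ?gt_eqF// lerBrDr.
  apply: le_trans (_ : b k.+1 * jac s k.+1 x <= _).
    by rewrite mulrDl lerD2l ler_pM2l// exprn_gt0.
  by rewrite ler_pM2r// xb.
case=> [|k] kn; first by rewrite jac0.
by have /andP[] := H k kn; exact: lt_le_trans.
Qed.

(* Such an x is necessarily the largest root of p_n. *)
Definition is_jac_top s n x :=
  [/\ 0 <= x, jac s n x = 0 & forall k, (k < n)%N -> 0 < jac s k x].

Lemma is_jac_top1 s : is_jac_top s 1 0.
Proof. by split=> //; [rewrite jac1 | case=> [|//] _; rewrite jac0]. Qed.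

(** By the recurrence p_(n+2) is negative at [x], and it is positive far to the right, so it has a
    root in between. *)
Lemma is_jac_topS s n x : 0 < s -> is_jac_top s n.+1 x ->
  exists2 y, x <= y & is_jac_top s n.+2 y.
Proof.
move=> s0 [x0 px pos].
have [M xM posM] := @jac_eventually_pos s n.+2 x s0.
have s_neq0 : s != 0 by rewrite gt_eqF.
have step y : jac s n.+1 y = 0 -> 0 < jac s n y -> jac s n.+2 y < 0.
  move=> e p; rewrite -(pmulr_rlt0 _ (exprn_gt0 n.+1 s0)) jacSS// e mulr0 sub0r.
  by rewrite oppr_lt0 mulr_gt0// exprn_gt0.
have neg : jac s n.+2 x < 0 by exact/step/pos.
have [|y /andP[xy yM] /rootP py] := @poly_ivt R (jacobi_poly s n.+2) _ _ xM.
  by apply/andP; split; [exact: ltW neg | exact: ltW (posM _ (leqnn _))].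
have posy k : (k < n.+1)%N -> 0 < jac s k y.
  move=> kn; apply: lt_le_trans (pos _ kn) _.
  apply: jac_le => //; last exact/ltW/pos.
  by move=> i ik; apply: pos; exact: ltn_trans kn.
exists y => //; split=> //; first exact: le_trans xy.
move=> k; rewrite ltnS leq_eqVlt => /predU1P[->|]; last exact: posy.
rewrite lt0r; apply/andP; split; last first.
  by rewrite -px; apply: jac_le; rewrite ?px.
(* A zero of p_(n+1) at [y] would make p_(n+2) negative there. *)
apply/eqP => e; have := step _ e (posy _ (leqnn _)).
by rewrite /jac py ltxx.
Qed.

(** A Christoffel-Darboux identity: the recurrence at [y], shifted by one, and [s] times that at [x]
    have the same weights, so the sum telescopes. The last bracket vanishes at consecutive top
    roots. *)
Lemma jac_wronskian s x y m : s != 0 ->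
  (y - s * x) * \sum_(i < m.+1) jac s i.+1 y * jac s i x =
  1 + s ^+ m.+1 * (jac s m.+2 y * jac s m x - jac s m.+1 y * jac s m.+1 x).
Proof.
move=> s0; elim: m => [|m IH].
  rewrite big_ord1 mulrBr !mulrA jacSS// !jac1 !jac0; ring.
rewrite big_ord_recr/= mulrDr IH.
have -> : s ^+ m.+2 * (jac s m.+3 y * jac s m.+1 x -
      jac s m.+2 y * jac s m.+2 x) =
    s ^+ m.+2 * jac s m.+3 y * jac s m.+1 x -
      s * jac s m.+2 y * (s ^+ m.+1 * jac s m.+2 x) by rewrite exprS; ring.
rewrite !jacSS// exprS; ring.
Qed.

Lemma jac_top_gap s x y n : 0 < s -> is_jac_top s n.+1 x ->
  is_jac_top s n.+2 y ->
  (y - s * x) * \sum_(i < n.+1) jac s i.+1 y * jac s i x = 1.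
Proof.
move=> s0 [_ px _] [_ py _].
by rewrite jac_wronskian ?gt_eqF// px py mul0r mulr0 subrr mulr0 addr0.
Qed.

Lemma jac_top_log_concave s n (w x y : R) : 0 < s ->
  is_jac_top s n.+1 w -> is_jac_top s n.+2 x -> is_jac_top s n.+3 y ->
  w <= x -> x <= y -> w * y <= x ^+ 2.
Proof.
move=> s0 tw tx ty wx xy.
have [[w0 _ pw] [_ _ px] [_ _ py]] := And3 tw tx ty.
have := jac_top_gap _ _ _ _ s0 tw tx; have := jac_top_gap _ _ _ _ s0 tx ty.
set S' := \sum_(i < n.+2) _; set S := \sum_(i < n.+1) _ => gxy gwx.
have term_gt0 (i : 'I_n.+1) : 0 < jac s i.+1 x * jac s i w.
  by rewrite mulr_gt0 ?pw ?px// ltnS.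
have S_gt0 : 0 < S.
  rewrite /S (bigD1 ord0)//= ltr_pwDl//; first exact: term_gt0 ord0.
  by apply: sumr_ge0 => i _; exact: ltW.
have SS' : S <= S'.
  rewrite /S' big_ord_recr/= -[leLHS]addr0 lerD//; last first.
    by rewrite ltW// mulr_gt0 ?px ?py.
  apply: ler_sum => i _; have [i1 i2] := (ltn_ord i, leqW (ltn_ord i)).
  apply: ler_pM.
  - by rewrite ltW ?px.
  - by rewrite ltW ?pw.
  - apply: jac_le => //; last by rewrite ltW ?px.
    by move=> k ki; apply: px; exact: ltn_trans ki _.
  - apply: jac_le => //; last by rewrite ltW ?pw.
    by move=> k ki; apply: pw; exact: ltn_trans ki _.
have gap_ge0 : 0 <= y - s * x.
  by rewrite -(pmulr_lge0 _ (lt_le_trans S_gt0 SS')) gxy.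
have gap_le : y - s * x <= x - s * w.
  by rewrite -(ler_pM2r S_gt0) gwx -gxy ler_wpM2l.
have : w * (y - s * x) <= x * (x - s * w) by rewrite ler_pM.
(* Both sides contain the term - s w x, which cancels. *)
by rewrite !mulrBr expr2 mulrCA (mulrCA x) [x * w]mulrC lerD2r.
Qed.

End JacobiPolynomials.

(** * Spectral radius from a positive eigenvector *)

Lemma normC_normc (R : rcfType) (z : R[i]) :
  `|z| = real_complex R (ComplexField.Normc.normc z).
Proof. by []. Qed.

(* Pairing the entrywise bound |z| |w| <= |w| A with the positive eigenvector
   yields |z| <= x. *)
Lemma spectral_radius_pos_eigenvector (R : realType) (n : nat) (A : 'M[R]_n.+1)
    (v : 'rV[R]_n.+1) (x : R) :
  A^T = A -> (forall i j, 0 <= A i j) -> (forall j, 0 < v 0 j) -> 0 <= x ->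
  v *m A = x *: v -> spectral_radius A = x.
Proof.
move=> symA A0 v0 x0 vA.
rewrite /spectral_radius; set E := (X in sup X).
pose C := real_complex R.
(* By symmetry [v] is also a right eigenvector. *)
have vA' i : \sum_j A i j * v 0 j = x * v 0 i.
  transitivity ((x *: v) 0 i); last by rewrite mxE.
  by rewrite -vA -{1}symA mxE; apply: eq_bigr => j _; rewrite mxE mulrC.
have Ex : E x.
  exists (C x); last first.
    by rewrite /C /= /real_complex_def/= expr0n addr0 sqrtr_sqr ger0_norm.
  apply/eigenvalueP; exists (map_mx C v).
    by rewrite -map_mxM vA map_mxZ.
  apply/eqP => /rowP /(_ 0); rewrite !mxE => /eqP.
  by rewrite fmorph_eq0 gt_eqF.
have ubE : ubound E x.
  move=> _ [z /eigenvalueP[w wA w0] <-].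
  suff : `|z| <= C x by rewrite normC_normc lecR.
  have Cv j : 0 < C (v 0 j) by rewrite ltcR.
  have CA i j : 0 <= C (A i j) by rewrite lecR.
  (* This positive pairing is the factor to be cancelled. *)
  have T_gt0 : 0 < \sum_j `|w 0 j| * C (v 0 j).
    have /existsP[j wj] : [exists j, w 0 j != 0].
      apply: contraNT w0 => /existsPn w0; apply/eqP/rowP => j.
      by rewrite mxE; apply/eqP/negPn.
    rewrite (bigD1 j)//= ltr_pwDl ?mulr_gt0 ?normr_gt0//.
    by apply: sumr_ge0 => k _; rewrite mulr_ge0// ltW.
  rewrite -(ler_pM2r T_gt0) !mulr_sumr.
  apply: (@le_trans _ _ (\sum_j \sum_i `|w 0 i| * C (A i j) * C (v 0 j))).
    apply: ler_sum => j _; rewrite mulrA -normrM.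
    have -> : z * w 0 j = \sum_i w 0 i * C (A i j).
      have : (z *: w) 0 j = z * w 0 j by rewrite mxE.
      by move=> <-; rewrite -wA mxE; apply: eq_bigr => i _; rewrite mxE.
    rewrite -mulr_suml ler_pM2r//; apply: le_trans (ler_norm_sum _ _ _) _.
    by apply: ler_sum => i _; rewrite normrM [`|C _|]ger0_norm.
  rewrite exchange_big; apply: ler_sum => i _ /=.
  under eq_bigr do rewrite -mulrA -rmorphM.
  by rewrite mulrCA -(rmorphM C) -vA' rmorph_sum mulr_sumr.
apply/eqP; rewrite eq_le; apply/andP; split.
  by apply: ge_sup => //; exists x.
by apply: ub_le_sup => //; exists x.
Qed.

(** * Identification of [lambda] with the largest root *)

(** The two cases exclude each other; as a sum, they split a matrix product into one-term sums. *)
Lemma tridiagE (R : realType) (n : nat) (r : R) (i j : 'I_n) : 0 < r ->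
  tridiag n r i j =
    (if j == i.+1 :> nat then Num.sqrt r ^+ i else 0) +
    (if i == j.+1 :> nat then Num.sqrt r ^+ j else 0).
Proof.
move=> r0.
have powE k : r `^ (k%:R / 2) = Num.sqrt r ^+ k.
  by rewrite mulrC powRrM powR12_sqrt ?ltW// powR_mulrn ?sqrtr_ge0.
rewrite mxE !powE; case: eqP => [ji|_]; last by rewrite add0r.
by case: eqP => [ij|_]; [lia|rewrite addr0].
Qed.

Lemma lambda_jac_top (R : realType) (n : nat) (r x : R) : 0 < r ->
  is_jac_top (Num.sqrt r) n.+1 x -> lambda n.+1 r = x.
Proof.
move=> r0 [x0 px pos]; set s := Num.sqrt r in px pos *.
have s0 : 0 < s by rewrite sqrtr_gt0.
apply: (@spectral_radius_pos_eigenvector _ _ _ (\row_i jac s i x)) => //.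
- by apply/matrixP => i j; rewrite mxE !tridiagE// addrC.
- move=> i j; rewrite tridiagE// addr_ge0//; case: ifP => // _;
    by rewrite exprn_ge0// ltW.
- by move=> j; rewrite mxE pos.
apply/rowP => j; rewrite !mxE.
under eq_bigr do rewrite mxE tridiagE// mulrDr -/s.
rewrite big_split/=.
(* In the last column no index matches, and the right side is zero because [x] is a root of
   p_(n+1). *)
have -> : \sum_(i < n.+1) jac s i x * (if i == j.+1 :> nat then s ^+ j else 0)
    = s ^+ j * jac s j.+1 x.
  have [jn|] := ltnP j.+1 n.+1.
    rewrite (bigD1 (Ordinal jn))//= eqxx big1 ?addr0 1?mulrC// => i.
    by rewrite -val_eqE/= => /negPf ->; rewrite mulr0.
  rewrite ltnS => nj; rewrite big1 => [|i _].
    by have -> : j = n :> nat by [have := ltn_ord j; lia]; rewrite px mulr0.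
  by case: eqP => [ij|_]; [have := ltn_ord i; lia | rewrite mulr0].
case: j => [[|j] jn] /=.
  by rewrite big1 ?add0r ?mul1r ?jac0 ?jac1 ?mulr1// => i _; rewrite mulr0.
have jn' := ltnW jn; rewrite (bigD1 (Ordinal jn'))//= eqxx big1 => [|i].
  by rewrite addr0 jacSS ?gt_eqF// [s ^+ j * _]mulrC; ring.
by rewrite -val_eqE/= eqSS eq_sym => /negPf ->; rewrite mulr0.
Qed.

(** Top roots are built one after another from the root 0 of p_1, each at least the previous one. *)
Lemma lambda_jac_topE (R : realType) (n : nat) (r : R) : 0 < r ->
  is_jac_top (Num.sqrt r) n.+1 (lambda n.+1 r) /\
  lambda n.+1 r <= lambda n.+2 r.
Proof.
move=> r0; have s0 : 0 < Num.sqrt r by rewrite sqrtr_gt0.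
have [x topx] : exists x, is_jac_top (Num.sqrt r) n.+1 x.
  elim: n => [|n [x /(is_jac_topS _ _ _ s0)[y _]]]; last by exists y.
  by exists 0; exact: is_jac_top1.
have [y xy topy] := is_jac_topS _ _ _ s0 topx.
by rewrite (lambda_jac_top _ _ _ _ r0 topx) (lambda_jac_top _ _ _ _ r0 topy).
Qed.

Theorem theorem7p3 (R : realType) (h : nat) (r : R)
    (h_ge2 : (2 <= h)%N) (r_gt0 : 0 < r) :
  lambda h r ^+ 2 >= lambda h.-1 r * lambda h.+1 r /\
  Lambda h r ^+ 2 >= Lambda h.-1 r * Lambda h.+1 r.
Proof.
case: h h_ge2 => [|[|n]]// _ /=.
have [tw wx] := lambda_jac_topE R n r r_gt0.
have [tx xy] := lambda_jac_topE R n.+1 r r_gt0.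
have [ty _] := lambda_jac_topE R n.+2 r r_gt0.
have s_gt0 : 0 < Num.sqrt r by rewrite sqrtr_gt0.
have lc := jac_top_log_concave _ _ _ _ _ s_gt0 tw tx ty wx xy.
(* The second inequality is the square of the first, whose sides are nonnegative. *)
split=> //; rewrite /Lambda -exprMn.
have [[w0 _ _] [y0 _ _]] := (tw, ty).
by rewrite lerXn2r// nnegrE ?mulr_ge0 ?exprn_ge0//; case: tx.
Qed.
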